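(* Let $\Theta_1,\Theta_2,\ldots$ be independent random variables with $\mathbb P(\Theta_j\le\theta)=\theta/(\theta+j-1)$ for $\theta\ge0$ (with the convention $0/0=1$, so $\Theta_1=0$ a.s.). For each $n\ge1$ and $\theta\ge0$, let $C_{n,\theta}$ be the random composition of $n$ whose binary representation is the sequence $(1(\Theta_j\le\theta))_{1\le j\le n}$, and let $(\Pi_{n,\theta},\theta\ge0)$ be the partition-valued process associated with $(C_{n,\theta},\theta\ge0)$. Then the sequence of processes $(\Pi_{n,\theta},\theta\ge0)$, $n=1,2,\ldots$, is a family of Ewens fragmentations.
   Context: A composition of $n$ is a sequence of positive integers $(n_1,\ldots,n_k)$ with sum $n$, viewed as $n$ unlabelled balls placed in an ordered sequence of $k$ nonempty boxes, the $i$th box containing $n_i$ balls. Its binary representation is the length-$n$ 0/1 sequence obtained by concatenating the words $10^{n_1-1},10^{n_2-1},\ldots,10^{n_k-1}$, i.e. the $1$'s are at positions $1,n_1+1,n_1+n_2+1,\ldots,n_1+\cdots+n_{k-1}+1$; conversely every 0/1 sequence of length $n$ starting with $1$ encodes a composition of $n$. Given a process $(C_{n,\theta},\theta\ge0)$ of compositions of $n$, the associated partition-valued process $(\Pi_{n,\theta},\theta\ge0)$ is obtained by labelling the $n$ ball positions (in left-to-right order across the boxes) by $\sigma(1),\ldots,\sigma(n)$, where $\sigma$ is a uniform random permutation of $[n]=\{1,\ldots,n\}$ independent of the composition process (the same $\sigma$ for all $\theta$), and then forgetting the order of the boxes, so that the sets of labels in the boxes form a partition of $[n]$. A family of Ewens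 fragmentations is a sequence, indexed by $n=1,2,\ldots$, of processes $(\Pi_{n,\theta},\theta\ge0)$ such that: (1) for each $n$ and $\theta\ge0$, $\Pi_{n,\theta}$ is a random partition of $[n]$ with $\mathbb P(\Pi_{n,\theta}=\pi)=\frac{\theta^{k-1}}{[\theta+1]_{n-1}}\prod_{i=1}^k(n_i-1)!$ for every partition $\pi$ of $[n]$ into $k$ blocks of sizes $n_1,\ldots,n_k$, where $[x]_m=x(x+1)\cdots(x+m-1)$; (2) for all $n$, $\Pi_{n,\theta}$ is a refinement of $\Pi_{n,\phi}$ whenever $\theta>\phi$ (each block of $\Pi_{n,\phi}$ is a union of blocks of $\Pi_{n,\theta}$); (3) for each $n<m$, the restriction of $(\Pi_{m,\theta},\theta\ge0)$ to $[n]$ has the same distribution (as a process) as $(\Pi_{n,\theta},\theta\ge0)$; (4) for each $n$ the law of $(\Pi_{n,\theta},\theta\ge0)$ is invariant under permutations of $[n]$. *)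

(* Defs.v *)
From HB Require Import structures.
From mathcomp Require Import all_boot all_order all_algebra all_fingroup.
From mathcomp Require Import all_classical all_reals all_analysis.
Set Implicit Arguments. Unset Strict Implicit. Unset Printing Implicit Defensive.
Import Order.TTheory GRing.Theory Num.Theory.
Local Open Scope ring_scope.

(* Conventions: [n] = {1,...,n} is represented by 'I_n = {0,...,n-1} (shift by 1).
   Ball positions are 0,...,n-1; the random variable Theta_j of the paper (j >= 1)
   is [Th (j-1)], i.e. [Th i] is Theta_{i+1}. *)

Section Finite.
Variable n : nat.

(* Positions i and i' of a 0/1 word b lie in the same box iff there is no 1 at
   any position k with min(i,i') < k <= max(i,i').  (Position 0 always starts a
   box, which agrees with the composition encoding since b starts with 1.) *)
Definition same_box (b : 'I_n -> bool) (i i' : 'I_n) : bool :=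
  [forall k : 'I_n, ((minn i i' < k)%N && (k <= maxn i i')%N) ==> ~~ b k].

Definition partition_of_word (b : 'I_n -> bool) (s : {perm 'I_n}) : {set {set 'I_n}} :=
  [set (s @: [set i | same_box b i0 i]) | i0 : 'I_n].

Definition refines (P Q : {set {set 'I_n}}) : bool :=
  [forall A in P, exists B in Q, A \subset B].

Definition perm_partition (s : {perm 'I_n}) (P : {set {set 'I_n}}) : {set {set 'I_n}} :=
  [set (s @: A) | A : {set 'I_n} in P].
End Finite.

Definition restr_partition (n m : nat) (P : {set {set 'I_m}}) : {set {set 'I_n}} :=
  [set [set i : 'I_n | [exists x in A, (x : nat) == (i : nat)]] | A : {set 'I_m} in P] :\ (@finset.set0 _).

Definition rising {R : numDomainType} (x : R) (m : nat) : R :=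
  \prod_(i < m) (x + i%:R).

Definition ewens_prob {R : numFieldType} (n : nat) (theta : R) (P : {set {set 'I_n}}) : R :=
  theta ^+ (#|P|.-1) / rising (theta + 1) n.-1 * \prod_(A in P) ((#|A|.-1)`!)%:R.

(* P(Theta_{j+1} <= theta) = theta/(theta + j), with the convention 0/0 = 1 *)
Definition Theta_cdf {R : numFieldType} (j : nat) (theta : R) : R :=
  if theta + j%:R == 0 then 1 else theta / (theta + j%:R).

Definition Pi_proc {d} {T : measurableType d} {R : realType}
  (Th : nat -> T -> R) (sigma : forall n : nat, T -> {perm 'I_n})
  (n : nat) (theta : R) (w : T) : {set {set 'I_n}} :=
  partition_of_word (fun i : 'I_n => Th (i : nat) w <= theta) (sigma n w).

Local Open Scope classical_set_scope.
Local Open Scope ereal_scope.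

(* A family of Ewens fragmentations.  Equality in law of processes indexed by
   theta >= 0 with values in a finite set is expressed through equality of all
   finite-dimensional distributions: for every finite list of pairs (theta_i, pi_i)
   with theta_i >= 0, P(X_{theta_i} = pi_i for all i) = P(Y_{theta_i} = pi_i for all i). *)
Definition EwensFragmentationFamily {d} {T : measurableType d} {R : realType}
  (P : probability T R) (Pi : forall n : nat, R -> T -> {set {set 'I_n}}) : Prop :=
  (forall (n : nat) (theta : R) (p : {set {set 'I_n}}),
      (0 < n)%N -> (0 <= theta)%R -> finset.partition p [set: 'I_n]%SET ->
      P [set w | Pi n theta w = p] = (ewens_prob theta p)%:E)
  /\ (forall n : nat, (0 < n)%N ->
      {ae P, forall w, forall phi theta : R, (0 <= phi)%R -> (phi < theta)%R ->
                         refines (Pi n theta w) (Pi n phi w)})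
  /\ (forall (n m : nat) (tp : seq (R * {set {set 'I_n}})),
      (0 < n)%N -> (n < m)%N -> all (fun q => (0 <= q.1)%R) tp ->
      P [set w | all (fun q => restr_partition n (Pi m q.1 w) == q.2) tp]
      = P [set w | all (fun q => Pi n q.1 w == q.2) tp])
  /\ (forall (n : nat) (s : {perm 'I_n}) (tp : seq (R * {set {set 'I_n}})),
      (0 < n)%N -> all (fun q => (0 <= q.1)%R) tp ->
      P [set w | all (fun q => perm_partition s (Pi n q.1 w) == q.2) tp]
      = P [set w | all (fun q => Pi n q.1 w == q.2) tp]).

(* Main.v *)
Require Import Defs.
From HB Require Import structures.
From mathcomp Require Import all_boot all_order all_algebra all_fingroup.
From mathcomp Require Import all_classical all_reals all_analysis.
From mathcomp Require Import ring zify.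
Set Implicit Arguments. Unset Strict Implicit. Unset Printing Implicit Defensive.
Import Order.TTheory GRing.Theory Num.Theory.
Local Open Scope ring_scope.

(** Refinement holds pointwise, and exchangeability is the invariance of the
    uniform law under translation.

    Ewens' formula: colour each label by its block.  A permutation produces the
    given partition only if its colours are contiguous, and the cuts are then
    forced, with probability proportional to a product of factors [j] (no cut
    before position [j]) or [theta] (cut).  Summing this weight over the
    permutations with a prescribed label in the last position gives a value that
    does not depend on this label, by induction on the number of labels.

    Consistency: removing the largest label deletes a uniform position [i] and
    replaces the gap variables [X_i], [X_{i+1}] next to it by their minimum.  Since
    [P(X_j > a) = j / (a + j)], the law of [min(X_i, X_{i+1})] is
    [(i+1) law(X_i) - i law(X_{i+1})], so that the average over [i] telescopes to
    the law of [(X_j)_{j < n}]. *)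

(** * Weighted arrangements of a colouring *)

Section LiftPermSums.
Variables (R : nmodType) (n : nat).

(** A permutation is determined by its image [j] of [i] and the induced permutation of the other
    points; injectivity and (n+1)! = (n+1) n! give the bijection. *)
Lemma sum_lift_perm_image (i : 'I_n.+1) (F : 'S_n.+1 -> R) :
  \sum_s F s = \sum_(j : 'I_n.+1) \sum_(s : 'S_n) F (lift_perm i j s).
Proof.
rewrite pair_big /= (reindex (fun u : 'I_n.+1 * 'S_n => lift_perm i u.1 u.2)) //.
apply: onW_bij; apply: inj_card_bij; last first.
  by rewrite card_prod card_ord !card_Sn factS.
move=> [j s] [j' s'] /= e.
have ej : j = j' by rewrite -(lift_perm_id i j s) e lift_perm_id.
congr pair => //; apply/permP => k; apply: (@lift_inj _ j).
by rewrite -(lift_perm_lift i) e -ej lift_perm_lift.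
Qed.

Lemma sum_lift_perm_preimage (j : 'I_n.+1) (F : 'S_n.+1 -> R) :
  \sum_s F s = \sum_(i : 'I_n.+1) \sum_(s : 'S_n) F (lift_perm i j s).
Proof.
rewrite (reindex_inj invg_inj) (sum_lift_perm_image j).
apply: eq_bigr => i _; rewrite (reindex_inj invg_inj).
by apply: eq_bigr => s _; rewrite lift_permV invgK.
Qed.

End LiftPermSums.

Section Arrangements.
Variables (R : comNzRingType) (theta : R).

Definition contiguous (K : eqType) (n : nat) (f : 'I_n -> K) : bool :=
  [forall i : 'I_n, forall j : 'I_n, forall k : 'I_n,
    [&& (i < j)%N, (j < k)%N & f i == f k] ==> (f j == f i)].

(** [lift ord_max j] and [lift ord0 j] are the neighbouring positions [j] and [j.+1]. The product is
    the probability of the forced cuts with the denominators [theta + j.+1] cleared. *)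
Definition colour_weight (K : eqType) (n : nat) (f : 'I_n.+1 -> K) : R :=
  (contiguous f)%:R *
  \prod_(j < n) (if f (lift ord_max j) == f (lift ord0 j) then j.+1%:R else theta).

Lemma contiguousP (K : eqType) (n : nat) (f : 'I_n -> K) :
  reflect (forall i j k : 'I_n, (i < j)%N -> (j < k)%N -> f i = f k -> f j = f i)
    (contiguous f).
Proof.
apply: (iffP forallP) => [h i j k ij jk fik | h i].
  by move/(_ i)/forallP/(_ j)/forallP/(_ k): h; rewrite ij jk fik eqxx => /eqP.
apply/forallP => j; apply/forallP => k; apply/implyP => /and3P[ij jk /eqP fik].
by apply/eqP/h/fik.
Qed.

Lemma contiguous_recr (K : eqType) (n : nat) (f : 'I_n.+2 -> K) :
  contiguous f =
  contiguous (fun i => f (lift ord_max i)) &&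
  ((f (lift ord_max ord_max) == f ord_max) ||
   [forall i, f (lift ord_max i) != f ord_max]).
Proof.
apply/contiguousP/andP => [h | [/contiguousP h h'] i j k].
  split; first by apply/contiguousP => i j k ij jk; apply: h; rewrite !lift_max.
  have [//|/= /eqP ne] := boolP (f (lift ord_max ord_max) == f ord_max).
  apply/forallP => i; apply/eqP => e; apply: ne.
  have [ei|ni] := eqVneq i ord_max; first by rewrite -e ei.
  rewrite -e; apply: (h _ _ ord_max); rewrite ?lift_max //=.
  by rewrite ltn_neqAle leq_ord andbT.
have lm (u : 'I_n.+2) : (u < n.+1)%N -> exists u' : 'I_n.+1, u = lift ord_max u'.
  by move=> un; exists (Ordinal un); apply: ord_inj; rewrite lift_max.
have [k' ->|->] := unliftP ord_max k.
  rewrite lift_max => ij jk.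
  have [j' ej] := lm j (ltn_trans jk (ltn_ord k')).
  have [i' ei] := lm i (ltn_trans ij (ltn_trans jk (ltn_ord k'))).
  by rewrite ei ej; apply: h; rewrite -(lift_max j') -ej // -lift_max -ei.
move=> ij jn; have [j' ej] := lm j jn.
have [i' ei] := lm i (ltn_trans ij jn).
rewrite ei ej => e; case/orP: h' => [/eqP e' | /forallP/(_ i')]; last by rewrite e eqxx.
have [->|nj] := eqVneq j' ord_max; first by rewrite e' e.
apply: (h i' j' ord_max); last by rewrite e' e.
  by move: ij; rewrite ei ej !lift_max.
by rewrite ltn_neqAle leq_ord andbT.
Qed.

Lemma colour_weight_recr (K : eqType) (n : nat) (f : 'I_n.+2 -> K) :
  colour_weight f =
  colour_weight (fun i => f (lift ord_max i)) *
  (if f (lift ord_max ord_max) == f ord_max then n.+1%:R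
   else theta * [forall i, f (lift ord_max i) != f ord_max]%:R).
Proof.
rewrite /colour_weight big_ord_recr contiguous_recr -mulnb natrM /= -!mulrA.
have -> : lift ord0 (ord_max : 'I_n.+1) = ord_max by apply: val_inj.
congr (_ * _); rewrite mulrCA; congr (_ * _).
  apply: eq_bigr => j _; congr (if f _ == f _ then _ else _).
    by congr lift; apply: ord_inj; rewrite lift_max.
  by apply: ord_inj; rewrite lift_max.
by case: eqP => _ /=; rewrite ?mul1r // mulrC.
Qed.

(* Summing over the label [x] in the last position as well gives Ewens' formula:
   that the value does not depend on [x] is what closes the induction. *)
Lemma sum_colour_weight (K : finType) (n : nat) (c : 'I_n.+1 -> K) (x : 'I_n.+1) :
  \sum_(s : 'S_n.+1 | s ord_max == x) colour_weight (fun i => c (s i)) =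
  (n`!)%:R * theta ^+ (#|[set c i | i : 'I_n.+1]%SET|.-1) *
  \prod_(k : K) ((#|[set i | c i == k]%SET|.-1)`!)%:R.
Proof.
elim: n c x => [|n IHn] c x.
  rewrite [LHS](eq_bigl xpredT) => [|s]; last by rewrite (ord1 (s _)) (ord1 x).
  rewrite [LHS](eq_bigr (fun _ => 1)) => [|s _]; last first.
    rewrite /colour_weight big_ord0 mulr1.
    suff -> : contiguous (fun i => c (s i)) by [].
    by apply/contiguousP => i j k; rewrite (ord1 i) (ord1 j).
  rewrite sumr_const card_Sn big1 => [|k _]; last first.
    have : (#|[set i | c i == k]%SET| <= 1)%N.
      by rewrite -[leqRHS](card_ord 1) max_card.
    by case: #|_| => [|[]].
  rewrite (_ : _.-1 = 0)%N ?expr0 ?mulr1 //.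
  have : (#|[set c i | i : 'I_1]%SET| <= 1)%N.
    by rewrite -[leqRHS](card_ord 1) leq_imset_card.
  by case: #|_| => [|[]].
pose c' i := c (lift x i).
pose r := #|[set i | c' i == c x]%SET|.
(* An arrangement ending in [x] is one of the other labels followed by [x]. The factor of [x] is
   [n.+1] after a label of its own colour, [theta] if its colour is new ([r = 0]), and 0 otherwise
   by contiguity. *)
transitivity (\sum_(s : 'S_n.+1) colour_weight (fun i => c' (s i)) *
    (if c' (s ord_max) == c x then n.+1%:R else theta * (r == 0%N)%:R)).
  rewrite big_mkcond (sum_lift_perm_image ord_max) (bigD1 x) //= [X in _ + X]big1.
    rewrite addr0; apply: eq_bigr => s _; rewrite lift_perm_id eqxx colour_weight_recr.
    rewrite lift_perm_lift lift_perm_id; congr (_ * _).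
      by congr colour_weight; apply: funext => i; rewrite lift_perm_lift.
    rewrite -/(c' _); case: ifP => // _; congr (_ * (nat_of_bool _)%:R).
    apply/forallP/eqP => [h | /cards0_eq h i].
      apply: eq_card0 => i; rewrite !inE; have := h (s^-1 i)%g.
      by rewrite lift_perm_lift permKV => /negbTE.
    rewrite lift_perm_lift; apply/negP => e.
    have : s i \in [set i | c' i == c x]%SET by rewrite inE.
    by rewrite h inE.
  by move=> y nyx; apply: big1 => s _; rewrite lift_perm_id (negbTE nyx).
(* Group by the label [y] just before [x]. The induction hypothesis gives the same value for every
   [y], so only the factors of [x] remain to be summed over [y]. *)
rewrite (partition_big (fun s : 'S_n.+1 => s ord_max) xpredT) //=.
under eq_bigr => y _ do (under eq_bigr => s /eqP -> do []; rewrite -mulr_suml IHn).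
rewrite -mulr_sumr.
have card_c k : #|[set i | c i == k]%SET| = ((k == c x) + #|[set i | c' i == k]%SET|)%N.
  rewrite -!sum1dep_card big_mkcond /= (bigD1_ord x) //= eq_sym.
  by rewrite -big_mkcond /=; case: eqP.
have img_c : [set c i | i : 'I_n.+2]%SET = c x |: [set c' i | i : 'I_n.+1]%SET.
  apply/setP => k; rewrite !inE; apply/imsetP/orP => [[i _ ->]|].
    have [i' ->|->] := unliftP x i; first by right; apply: imset_f.
    by left.
  by case=> [/eqP ->|/imsetP[i' _ ->]]; [exists x | exists (lift x i')].
rewrite (bigD1 (c x)) //= [X in _ = _ * X](bigD1 (c x)) //= card_c eqxx -/r.
under [X in _ = _ * (_ * X)]eq_bigr => k nk do rewrite card_c (negbTE nk) add0n.
set Q := \prod_(_ | _) _; rewrite img_c cardsU1 add1n /= factS natrM.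
set I' := [set c' i | i : 'I_n.+1]%SET.
(* If the colour of [x] is new, each of the [n.+1] labels [y] gives [theta] and the number of
   colours grows by one. Otherwise [r] labels give [n.+1] each, and r (r-1)! = r!. *)
have [r0|r0] := posnP r.
  have nI : c x \notin I'.
    apply/negP => /imsetP[i _ e].
    have : i \in [set i | c' i == c x]%SET by rewrite inE -e.
    by rewrite (cards0_eq r0) inE.
  have I0 : (0 < #|I'|)%N by apply/card_gt0P; exists (c' ord0); apply: imset_f.
  rewrite nI r0 add1n /= -(prednK I0) exprS.
  rewrite (eq_bigr (fun _ => theta)) => [|y _]; last first.
    rewrite mulr1 ifN //; apply/negP => /eqP e; case/negP: nI.
    by rewrite -e; apply: imset_f.
  by rewrite sumr_const card_ord -mulr_natl; ring.
have /card_gt0P[y] := r0; rewrite inE => /eqP ey.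
have -> : c x \in I' by rewrite -ey; apply: imset_f.
rewrite (eq_bigr (fun y => if c' y == c x then n.+1%:R else 0)) => [|z _]; last first.
  by rewrite mulr0.
rewrite -big_mkcond /= [X in _ * X = _](_ : _ = n.+1%:R *+ r); last first.
  by rewrite sumr_const /r cardsE.
rewrite add0n -{3}(prednK r0) factS (prednK r0) natrM -(mulr_natl _ r).
ring.
Qed.

End Arrangements.

(** * Words and partitions *)

Section SameBox.
Variable n : nat.
Implicit Types (b : 'I_n -> bool) (i j k : 'I_n).

Lemma same_boxP b i j :
  reflect (forall k, (minn i j < k)%N -> (k <= maxn i j)%N -> ~~ b k) (same_box b i j).
Proof.
apply: (iffP forallP) => h k; last by apply/implyP => /andP[? ?]; apply: h.
by move=> h1 h2; have := h k; rewrite h1 h2.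
Qed.

Lemma same_box_refl b i : same_box b i i.
Proof. by apply/same_boxP => k; lia. Qed.

Lemma same_box_sym b i j : same_box b i j = same_box b j i.
Proof. by rewrite /same_box minnC maxnC. Qed.

Lemma same_box_trans b i j k : same_box b i j -> same_box b j k -> same_box b i k.
Proof.
move=> /same_boxP ij /same_boxP jk; apply/same_boxP => l h1 h2.
have : (minn i j < l)%N && (l <= maxn i j)%N || (minn j k < l)%N && (l <= maxn j k)%N.
  by lia.
by case/orP => /andP[]; [apply: ij | apply: jk].
Qed.

Lemma same_box_anti b b' i j :
  (forall k, b k -> b' k) -> same_box b' i j -> same_box b i j.
Proof.
move=> bb' /same_boxP h; apply/same_boxP => k h1 h2.
by apply: contra (h k h1 h2); apply: bb'.
Qed.

Lemma refines_partition_of_word b b' (s : 'S_n) :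
  (forall k, b k -> b' k) -> refines (partition_of_word b' s) (partition_of_word b s).
Proof.
move=> bb'; apply/forallP => A; apply/implyP => /imsetP[i _ ->].
apply/existsP; exists (s @: [set j | same_box b i j]); apply/andP; split.
  by apply/imsetP; exists i.
by apply/imsetS/fintype.subsetP => j; rewrite !inE; apply: same_box_anti.
Qed.

Lemma perm_partition_of_word b (s t : 'S_n) :
  perm_partition t (partition_of_word b s) = partition_of_word b (s * t)%g.
Proof.
rewrite /perm_partition /partition_of_word -imset_comp.
apply: eq_imset => i /=; rewrite -imset_comp.
by apply: eq_imset => j /=; rewrite permM.
Qed.

(** Colouring each position by the block of its label turns an equality of partitions into a
    condition on pairs of positions. *)
Lemma partition_of_word_eq b (s : 'S_n) (p : {set {set 'I_n}}) :
  finset.partition p [set: 'I_n]%SET ->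
  partition_of_word b s = p <->
  (forall i j, same_box b i j = (finset.pblock p (s i) == finset.pblock p (s j))).
Proof.
move=> /and3P[/eqP cov tI n0]; split=> [e i j | h].
  have blk k l : same_box b k l -> finset.pblock p (s l) = s @: [set m | same_box b k m].
    move=> kl; apply: finset.def_pblock => //; first by rewrite -e; apply/imsetP; exists k.
    by rewrite imset_f // inE.
  apply/idP/eqP => [ij | e'].
    by rewrite (blk _ _ ij) (blk _ _ (same_box_refl b i)).
  have : s j \in finset.pblock p (s i) by rewrite e' finset.mem_pblock cov.
  rewrite (blk _ _ (same_box_refl b i)) => /imsetP[k].
  by rewrite inE => ik /perm_inj ->.
have blk i : s @: [set j | same_box b i j] = finset.pblock p (s i).
  apply/setP => x; rewrite -[x](permKV s); set j := (s^-1)%g x.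
  rewrite mem_imset; last exact: perm_inj.
  by rewrite inE h finset.eq_pblock // cov.
apply/setP => A; apply/imsetP/idP => [[i _ ->] | Ap].
  by rewrite blk finset.pblock_mem // cov.
have [A0|[x xA]] := set_0Vmem A; first by rewrite A0 (negbTE n0) in Ap.
exists (s^-1 x)%g => //; rewrite blk permKV; apply/esym.
exact: finset.def_pblock.
Qed.

End SameBox.

(** The letter at position 0 is left free: a separating cut lies strictly to the right of one of the
    two positions, so [same_box] never reads that letter. *)
Lemma same_box_colouring (K : eqType) (n : nat) (b : 'I_n.+1 -> bool) (f : 'I_n.+1 -> K) :
  (forall i j, same_box b i j = (f i == f j)) <->
  contiguous f /\
  (forall j : 'I_n, b (lift ord0 j) = (f (lift ord_max j) != f (lift ord0 j))).
Proof.
split=> [h | [/contiguousP cf h] i j].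
  split.
    apply/contiguousP => i j k ij jk /eqP; rewrite -h => /same_boxP ik.
    apply/eqP; rewrite eq_sym -h; apply/same_boxP => l h1 h2.
    by apply: ik; lia.
  move=> j; rewrite -h; apply/idP/idP => [bj | ].
    by apply/same_boxP => /(_ (lift ord0 j)); rewrite bj !lift_max !lift0; lia.
  apply: contraNT => nbj; apply/same_boxP => k; rewrite lift_max lift0 => h1 h2.
  by rewrite (_ : k = lift ord0 j) //; apply: ord_inj; rewrite lift0; lia.
wlog ij : i j / (i <= j)%N => [hw|].
  by case: (leqP i j) => [/hw //|/ltnW/hw]; rewrite same_box_sym eq_sym.
have pred_succ (k : 'I_n.+1) : (i < k)%N -> exists2 l : 'I_n,
    k = lift ord0 l & (i <= lift ord_max l)%N.
  move=> ik; have kn : (k.-1 < n)%N by have := ltn_ord k; lia.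
  exists (Ordinal kn); first by apply: ord_inj; rewrite lift0 /=; lia.
  by rewrite lift_max /=; lia.
apply/same_boxP/eqP => [hb | fij k].
  (* Walk from [j] down to [i]: where there is no cut, a position has the colour of its
     predecessor. *)
  have [m jm] := ubnP (j : nat); elim: m j jm ij hb => // m IH j jm ij hb.
  have [->//|ne] := eqVneq i j.
  have ltij : (i < j)%N by rewrite ltn_neqAle ne.
  have [l ej il] := pred_succ _ ltij.
  have : ~~ b (lift ord0 l) by rewrite -ej; apply: hb; lia.
  rewrite h -ej negbK => /eqP <-.
  have := lift_max l; have := lift0 l; rewrite -ej => e1 e2.
  by apply: IH; rewrite ?e2 //; try lia; move=> k h1 h2; apply: hb; lia.
rewrite (minn_idPl ij) (maxn_idPr ij) => ik kj.
(* Contiguity spreads the common colour of [i] and [j] over the whole range, so no cut occurs in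
   it. *)
have fk (l : 'I_n.+1) : (i <= l)%N -> (l <= j)%N -> f l = f i.
  rewrite leq_eqVlt => /predU1P[/ord_inj ->//|il].
  rewrite leq_eqVlt => /predU1P[/ord_inj ->//|lj].
  exact: (cf _ _ j).
have [l ek il] := pred_succ _ ik; rewrite ek h negbK (fk (lift ord0 l)) -?ek //.
  rewrite fk //; move: kj; rewrite ek lift0 lift_max; lia.
exact: ltnW.
Qed.

(* Deleting the ball at position [i] merges the two gaps next to it; a cut in either
   of them survives as a cut at position [i] of the shorter word. *)
Definition delete_letter (n : nat) (i : 'I_n.+1) (b : 'I_n.+1 -> bool) (k : 'I_n) : bool :=
  b (lift i k) || ((k == i :> nat) && b i).

Lemma same_box_delete (n : nat) (i : 'I_n.+1) (b : 'I_n.+1 -> bool) (k l : 'I_n) :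
  same_box (delete_letter i b) k l = same_box b (lift i k) (lift i l).
Proof.
have liftE (m : 'I_n) : lift i m = ((i <= m)%N + m)%N :> nat by [].
apply/same_boxP/same_boxP => h m.
  have [m' ->|->] := unliftP i m.
    rewrite !liftE => h1 h2; have : ~~ delete_letter i b m' by apply: h; lia.
    by rewrite negb_or => /andP[].
  rewrite !liftE => h1 h2.
  (* Position [i] is in the range only if a surviving position follows it, so [i < n]; its cut has
     moved to position [i] of the shorter word. *)
  have mn : (i < n)%N by have := ltn_ord k; have := ltn_ord l; lia.
  have : ~~ delete_letter i b (Ordinal mn) by apply: h => /=; lia.
  by rewrite negb_or /= eqxx => /andP[].
move=> h1 h2; rewrite negb_or negb_and; apply/andP; split.
  by apply: h; rewrite !liftE; lia.
case: eqP => //= e; apply: h; rewrite !liftE; lia.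
Qed.

(** * Restriction of partitions to the smallest labels *)

Definition trace (n m : nat) (A : {set 'I_m}) : {set 'I_n} :=
  [set i : 'I_n | [exists x in A, (x : nat) == (i : nat)]].

Lemma restr_partitionE (n m : nat) (p : {set {set 'I_m}}) :
  restr_partition n p = [set trace n A | A : {set 'I_m} in p] :\ finset.set0.
Proof. by []. Qed.

Lemma in_trace (n m : nat) (A : {set 'I_m}) (i : 'I_n) (x : 'I_m) :
  x = i :> nat -> (i \in trace n A) = (x \in A).
Proof.
move=> xi; rewrite inE; apply/existsP/idP => [[y /andP[yA /eqP e]] | xA].
  by rewrite (_ : x = y) //; apply: ord_inj; rewrite e xi.
by exists x; rewrite xA xi eqxx.
Qed.

Lemma trace_trace (n m l : nat) (A : {set 'I_l}) :
  (n <= m)%N -> (m <= l)%N -> trace n (trace m A) = trace n A.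
Proof.
move=> nm ml; apply/setP => i.
pose x := widen_ord ml (widen_ord nm i).
by rewrite (in_trace _ (x := widen_ord nm i)) // !(in_trace _ (x := x)).
Qed.

Lemma restr_restr_partition (n m l : nat) (p : {set {set 'I_l}}) :
  (n <= m)%N -> (m <= l)%N ->
  restr_partition n (restr_partition m p) = restr_partition n p.
Proof.
move=> nm ml; rewrite !restr_partitionE; apply/setP => B; rewrite !in_setD1.
apply: andb_id2l => B0; apply/imsetP/imsetP => [[A]|[A Ap eB]].
  by rewrite in_setD1 => /andP[_ /imsetP[C Cp ->] ->]; exists C; rewrite ?trace_trace.
exists (trace m A); last by rewrite trace_trace.
rewrite in_setD1 imset_f // andbT; apply: contraNN B0 => /eqP A0.
rewrite eB -(trace_trace A nm ml) A0; apply/eqP/setP => i.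
by rewrite (in_trace _ (x := widen_ord nm i)) // !inE.
Qed.

(** [lift_perm i ord_max s] puts the largest label at position [i], so forgetting this label deletes
    that position. If the label was alone in its box, the trace is empty and [restr_partition]
    discards it. *)
Lemma restr_partition_of_word (n : nat) (b : 'I_n.+1 -> bool) (i : 'I_n.+1) (s : 'S_n) :
  restr_partition n (partition_of_word b (lift_perm i ord_max s)) =
  partition_of_word (delete_letter i b) s.
Proof.
set t := lift_perm i ord_max s.
have trE (k : 'I_n.+1) (j : 'I_n) :
    (s j \in trace n (t @: [set l | same_box b k l])) = same_box b k (lift i j).
  rewrite (in_trace _ (x := t (lift i j))).
    by rewrite mem_imset ?inE //; apply: perm_inj.
  by rewrite /t lift_perm_lift lift_max.
have tr k (j : 'I_n) : same_box b k (lift i j) ->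
    trace n (t @: [set l | same_box b k l]) =
    s @: [set l | same_box (delete_letter i b) j l].
  move=> kj; apply/setP => x; rewrite -[x](permKV s) trE mem_imset ?inE; last exact: perm_inj.
  rewrite same_box_delete; apply/idP/idP; last exact: same_box_trans.
  by apply: same_box_trans; rewrite same_box_sym.
rewrite restr_partitionE; apply/setP => B; rewrite in_setD1.
apply/andP/imsetP => [[B0 /imsetP[A /imsetP[k _ ->] eB]] | [j _ ->]].
  have [e|[x xB]] := set_0Vmem B; first by rewrite e eqxx in B0.
  have kx : same_box b k (lift i (s^-1 x)%g) by rewrite -trE permKV -eB.
  by exists (s^-1 x)%g => //; rewrite eB; apply: tr.
split.
  by apply/set0Pn; exists (s j); rewrite imset_f // inE same_box_refl.
rewrite -(tr (lift i j)) ?same_box_refl //; apply: imset_f.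
exact: imset_f.
Qed.

(** * Deletion of a uniform position *)

(** The system is triangular for inclusion: once [g] and [h] agree on the proper subsets of [B],
    cancelling these terms leaves the value at [B]. *)
Lemma sum_subset_inj (V : zmodType) (I : finType) (g h : {set I} -> V) :
  (forall B : {set I},
    \sum_(A : {set I} | A \subset B) g A = \sum_(A : {set I} | A \subset B) h A) ->
  g =1 h.
Proof.
move=> gh B; have [m] := ubnP #|B|; elim: m B => // m IH B /ltnSE Bm.
have := gh B; rewrite (bigD1 B) //= [RHS](bigD1 B) //=.
rewrite (eq_bigr h); first exact: addIr.
move=> A /andP[AB nAB]; apply: IH; apply: leq_trans Bm.
by apply: proper_card; rewrite finset.properEneq nAB.
Qed.

Section DeletionLaw.
Variables (R : comNzRingType) (I : finType) (mu : nat -> {set I} -> R).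
Hypothesis mu1 : forall j, \sum_A mu j A = 1.
Let cumul j (B : {set I}) := \sum_(A : {set I} | A \subset B) mu j A.
Hypothesis cumul_mul : forall j B,
  cumul j B * cumul j.+1 B = j.+1%:R * cumul j B - j%:R * cumul j.+1 B.

(** The union of two independent sets lies in [C] iff both do, so its cumulative sums are products,
    which [cumul_mul] makes linear; [sum_subset_inj] goes back from cumulative sums to laws. *)
Lemma law_setU j (C : {set I}) :
  \sum_A \sum_(B : {set I} | B :|: A == C) mu j A * mu j.+1 B =
  j.+1%:R * mu j C - j%:R * mu j.+1 C.
Proof.
move: C; apply: sum_subset_inj => C.
rewrite exchange_big /= sumrB -!mulr_sumr -cumul_mul /cumul big_distrlr /=.
rewrite [RHS]big_mkcond; apply: eq_bigr => A _.
rewrite (exchange_big_dep xpredT) //=.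
have [AC|nAC] := boolP (A \subset C); last first.
  apply: big1 => B _; apply: big1 => D /andP[DC /eqP e].
  by case/negP: nAC; apply: fintype.subset_trans DC; rewrite -e finset.subsetUr.
rewrite [RHS]big_mkcond; apply: eq_bigr => B _.
have [BC|nBC] := boolP (B \subset C); last first.
  apply: big1 => D /andP[DC /eqP e].
  by case/negP: nBC; apply: fintype.subset_trans DC; rewrite -e finset.subsetUl.
rewrite (big_pred1 (B :|: A)) // => D.
rewrite pred1E eq_sym /= andbC; case: eqP => //= ->.
by rewrite finset.subUset BC AC.
Qed.

Variable n : nat.
Implicit Types (i : 'I_n.+1) (G : {ffun 'I_n -> {set I}} -> R).

(* [delete_letter] at all levels simultaneously: [A j] is the set of levels at
   which the word has a cut at position [j]. *)
Definition merge_gaps i (A : {ffun 'I_n.+1 -> {set I}}) : {ffun 'I_n -> {set I}} :=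
  [ffun k : 'I_n => A (lift i k) :|: (if k == i :> nat then A i else finset.set0)].

(** The mean of [G] over independent letters when position [i] is left out. *)
Let skip G (i : nat) := \sum_C G C * \prod_(k < n) mu (bump i k) (C k).

(** Given the value [a] at the deleted position, each letter of [C] constrains a single remaining
    position, so the sum factorises. *)
Lemma sum_merge_fiber i (C : {ffun 'I_n -> {set I}}) :
  \sum_(A | merge_gaps i A == C) \prod_(j < n.+1) mu j (A j) =
  \sum_a mu i a * \prod_(k < n)
    \sum_(x : {set I} | x :|: (if k == i :> nat then a else finset.set0) == C k) mu (bump i k) x.
Proof.
rewrite (partition_big (fun A : {ffun 'I_n.+1 -> {set I}} => A i) xpredT) //=.
apply: eq_bigr => a _.
pose Q (j : 'I_n.+1) : pred {set I} := fun x =>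
  if unlift i j is Some k
  then x :|: (if k == i :> nat then a else finset.set0) == C k else x == a.
transitivity (\prod_(j < n.+1) \sum_(x | Q j x) mu j x).
  rewrite bigA_distr_big_dep /=; apply: eq_bigl => A.
  apply/andP/familyP => [[/eqP eC /eqP ea] j | h].
    rewrite /Q unfold_in; case: unliftP => [k|] ->; last by rewrite ea.
    by rewrite -eC ffunE ea.
  have ea : A i = a by apply/eqP; have := h i; rewrite unfold_in /Q unlift_none.
  split; apply/eqP => //; apply/ffunP => k; rewrite ffunE ea.
  by apply/eqP; have := h (lift i k); rewrite unfold_in /Q liftK.
rewrite (bigD1_ord i) //=; congr (_ * _).
  by rewrite (big_pred1 a) // => x; rewrite /Q unlift_none.
by apply: eq_bigr => k _; apply: eq_bigl => x; rewrite /Q liftK.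
Qed.

(** For [i < n] only the letter at [i] is merged, and [law_setU] gives its law: the term in [mu i]
    amounts to skipping [i.+1], the term in [mu i.+1] to skipping [i]. For [i = n] nothing is merged
    and the last letter sums to 1. *)
Lemma sum_merge i G :
  \sum_A G (merge_gaps i A) * \prod_(j < n.+1) mu j (A j) =
  if (i < n)%N then i.+1%:R * skip G i.+1 - i%:R * skip G i else skip G i.
Proof.
rewrite (partition_big (merge_gaps i) xpredT) //=.
under eq_bigr => C _ do
  (under eq_bigr => A /eqP -> do []; rewrite -mulr_sumr sum_merge_fiber).
case: ifPn => [ltin | nlt].
  rewrite /skip !mulr_sumr -sumrB; apply: eq_bigr => C _.
  pose i0 := Ordinal ltin.
  transitivity (G C * ((\prod_(k < n | k != i0) mu (bump i k) (C k)) *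
    (i.+1%:R * mu i (C i0) - i%:R * mu i.+1 (C i0)))).
    congr (_ * _); rewrite -law_setU mulr_sumr; apply: eq_bigr => a _.
    rewrite (bigD1 i0) //= eqxx mulrA mulr_sumr mulrC.
    rewrite {2}/bump leqnn; congr (_ * _).
    apply: eq_bigr => k nk; rewrite ifN; last by [].
    by rewrite (big_pred1 (C k)) // => x; rewrite finset.setU0.
  rewrite [X in _ = _ * (_ * X) - _](bigD1 i0) //= [X in _ - _ * (_ * X)](bigD1 i0) //=.
  have -> : bump i i = i.+1 by rewrite /bump leqnn.
  have -> : bump i.+1 i = i by rewrite /bump ltnn.
  (* [bump i] and [bump i.+1] differ only at [i]. *)
  rewrite (eq_bigr (fun k : 'I_n => mu (bump i.+1 k) (C k))) => [|k nk]; last first.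
    by rewrite /bump [(i < k)%N]ltn_neqAle eq_sym (_ : (k == i :> nat) = false) //; apply/negbTE.
  by ring.
apply: eq_bigr => C _; congr (_ * _).
rewrite (eq_bigr (fun a => mu i a * \prod_(k < n) mu (bump i k) (C k))) => [|a _].
  by rewrite -mulr_suml mu1 mul1r.
congr (_ * _); apply: eq_bigr => k _.
rewrite ifN; first by rewrite (big_pred1 (C k)) // => x; rewrite finset.setU0.
by have := ltn_ord k; lia.
Qed.

(** The terms with [i < n] telescope to [n%:R * skip G n], the last one is [skip G n], and [bump n]
    is the identity below [n]. *)
Lemma sum_merge_positions G :
  \sum_(i < n.+1) \sum_A G (merge_gaps i A) * \prod_(j < n.+1) mu j (A j) =
  n.+1%:R * \sum_A G A * \prod_(j < n) mu j (A j).
Proof.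
under eq_bigr => i _ do rewrite sum_merge.
have -> : \sum_A G A * \prod_(j < n) mu j (A j) = skip G n.
  apply: eq_bigr => C _; congr (_ * _); apply: eq_bigr => k _.
  by rewrite /bump leqNgt ltn_ord.
rewrite big_ord_recr /= ltnn.
under eq_bigr => i _ do rewrite ltn_ord.
rewrite (_ : \sum_(i < n) _ = n%:R * skip G n); first by rewrite -natr1 mulrDl mul1r.
rewrite -(big_mkord xpredT (fun j : nat => j.+1%:R * skip G j.+1 - j%:R * skip G j)).
by rewrite (telescope_sumr (fun j : nat => j%:R * skip G j)) // mul0r subr0.
Qed.

End DeletionLaw.

(** * Laws of the fragmentation processes *)

Local Open Scope classical_set_scope.

Lemma probability_finite_rv (d : measure_display) (T : measurableType d) (R : realType)
    (P : probability T R) (F : finType) (X : T -> F) (phi : pred F) :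
  (forall x, measurable [set w | X w = x]) ->
  P [set w | phi (X w)] = (\sum_(x | phi x) fine (P [set w | X w = x]))%:E.
Proof.
move=> mX.
have -> : [set w | phi (X w)] = \bigcup_(x in [set` phi]) (X @^-1` [set x]).
  by apply/seteqP; split=> [w /= h | w [x /= h e]]; [exists (X w) | rewrite [X w]e].
rewrite measure_fin_bigcup //; [|exact: trivIset_preimage1|by move=> x _; apply: mX].
rewrite -(bigfs _ (r := index_enum F)) ?index_enum_uniq //; last first.
  by move=> x _; rewrite mem_index_enum.
rewrite -sumEFin; apply: eq_bigr => x _.
by rewrite fineK //; apply: fin_num_measure; apply: mX.
Qed.

Lemma one_sub_Theta_cdf (R : numFieldType) (j : nat) (theta : R) :
  0 <= theta -> 1 - Theta_cdf j theta = j%:R / (theta + j%:R).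
Proof.
(* When the denominator vanishes, the distribution function is 1 by convention and the quotient is 0
   because the inverse of 0 is 0. *)
move=> t0; rewrite /Theta_cdf; case: eqP => [e|/eqP ne]; last by field.
by rewrite subrr e invr0 mulr0.
Qed.

Lemma Theta_survival_mul (R : numFieldType) (j : nat) (theta : R) : 0 <= theta ->
  let S k := 1 - Theta_cdf k theta in
  S j * S j.+1 = j.+1%:R * S j - j%:R * S j.+1.
Proof.
move=> t0 /=; rewrite !one_sub_Theta_cdf //.
(* For [j = 0] the denominator may be zero, so this case is settled apart: both sides are 0. *)
case: j => [|j]; first by rewrite !mul0r mulr0 subr0.
have h k : theta + k.+1%:R != 0 by rewrite gt_eqF // ltr_wpDl // ltr0Sn.
have := h j; have := h j.+1; rewrite -!natr1 => h1 h2.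
by field; rewrite h1 h2.
Qed.

Section Process.
Context {d : measure_display} {T : measurableType d} {R : realType}.
Variables (P : probability T R) (Th : nat -> T -> R).
Variable sigma : forall n : nat, T -> {perm 'I_n}.
Hypothesis mTh : forall j, measurable_fun setT (Th j).
Hypothesis msigma :
  forall (n : nat) (s : {perm 'I_n}), measurable [set w | sigma n w = s].
Hypothesis cdfTh : forall (j : nat) (theta : R), 0 <= theta ->
  P [set w | Th j w <= theta] = (Theta_cdf j theta)%:E.
Hypothesis indepTh :
  forall (J : seq nat) (B : nat -> set R), uniq J -> (forall j, measurable (B j)) ->
  P [set w | forall j, j \in J -> B j (Th j w)] =
  (\prod_(j <- J) P [set w | B j (Th j w)])%E.
Hypothesis indep_sigma :
  forall (n : nat) (s : {perm 'I_n}) (J : seq nat) (B : nat -> set R),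
  (forall j, measurable (B j)) ->
  P [set w | sigma n w = s /\ forall j, j \in J -> B j (Th j w)] =
  (((n`!%:R)^-1)%:E * P [set w | forall j, j \in J -> B j (Th j w)])%E.

(** * Joint law of the permutation and of the discretised variables *)

Section FiniteValued.
Variables (D : finType) (psi : R -> D).
Hypothesis mpsi : forall a, measurable [set x | psi x = a].

Definition law (j : nat) (a : D) : R := fine (P [set w | psi (Th j w) = a]).

Lemma measurable_psi_Th j a : measurable [set w | psi (Th j w) = a].
Proof. by have := mTh j measurableT (mpsi a); rewrite setTI. Qed.

Lemma sum_law j (phi : pred D) :
  (\sum_(a | phi a) law j a)%:E = P [set w | phi (psi (Th j w))].
Proof.
by rewrite (@probability_finite_rv _ _ _ P _ (psi \o Th j) phi) // => a; apply: measurable_psi_Th.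
Qed.

Lemma sum_lawT j : \sum_a law j a = 1.
Proof.
apply: EFin_inj; rewrite (sum_law j xpredT) -(probability_setT P).
by congr (P _); apply/seteqP; split.
Qed.

Lemma probability_process (n : nat) (phi : 'S_n -> {ffun 'I_n -> D} -> bool) :
  P [set w | phi (sigma n w) [ffun j : 'I_n => psi (Th j w)]] =
  (\sum_s \sum_A (phi s A)%:R * ((n`!%:R)^-1 * \prod_(j < n) law j (A j)))%:E.
Proof.
pose X w := (sigma n w, [ffun j : 'I_n => psi (Th j w)]).
rewrite (@probability_finite_rv _ _ _ P _ X (fun u => phi u.1 u.2)); last first.
  move=> [s A].
  have -> : [set w | X w = (s, A)] =
      [set w | sigma n w = s] `&` \bigcap_(j in [set: 'I_n]) [set w | psi (Th j w) = A j].
    apply/seteqP; split=> [w [<- <-]|w [/= <- h]].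
      by split => // j _; rewrite /= ffunE.
    by congr pair; apply/ffunP => j; rewrite ffunE; apply: h.
  apply: measurableI; first exact: msigma.
  apply: fin_bigcap_measurable; first exact: finite_finset.
  by move=> j _; apply: measurable_psi_Th.
congr EFin; rewrite big_mkcond pair_big /=; apply: eq_bigr => -[s A] _ /=.
case: (phi s A); last by rewrite mul0r.
rewrite mul1r.
(* The independence hypotheses take sets indexed by all of [nat]; indices from [n] on get the whole
   line. *)
pose B j : set R := if insub j is Some k then [set x | psi x = A k] else setT.
have mB j : measurable (B j) by rewrite /B; case: insub.
have -> : [set w | X w = (s, A)] =
    [set w | sigma n w = s /\ forall j, j \in index_iota 0 n -> B j (Th j w)].
  apply/seteqP; split=> [w [es eA]|w [<- h]].
    split => // j; rewrite mem_index_iota /= => jn.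
    by rewrite /B insubT /= -eA ffunE.
  congr pair; apply/ffunP => j; rewrite ffunE; have := h j.
  by rewrite mem_index_iota ltn_ord /B valK => /(_ isT).
rewrite indep_sigma // indepTh //; last exact: iota_uniq.
rewrite big_mkord.
rewrite (eq_bigr (fun j : 'I_n => (law j (A j))%:E)) => [|j _]; last first.
  rewrite /B valK /law fineK //; apply: fin_num_measure.
  exact: measurable_psi_Th.
by rewrite prodEFin.
Qed.

End FiniteValued.

Lemma measurable_le_level (theta : R) (a : bool) :
  measurable [set x : R | (x <= theta) = a].
Proof.
have mle : measurable [set x : R | x <= theta].
  by rewrite -set_itvNyc; apply: measurable_itv.
case: a; first by rewrite (_ : [set x | _] = [set x : R | x <= theta]).
rewrite (_ : [set x | _] = ~` [set x : R | x <= theta]); first exact: measurableC.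
by apply/seteqP; split=> x /=; [move=> -> | move/negP/negbTE].
Qed.

(** * The one-dimensional law: Ewens' formula *)

Section EwensLaw.
Variable theta : R.
Hypothesis theta_ge0 : 0 <= theta.
Let level (x : R) : bool := x <= theta.

Lemma law_level j (a : bool) :
  law level j.+1 a = (if a then theta else j.+1%:R) / (theta + j.+1%:R).
Proof.
have ne : theta + j.+1%:R != 0 by rewrite gt_eqF // ltr_wpDl // ltr0Sn.
have lawt : law level j.+1 true = theta / (theta + j.+1%:R).
  rewrite /law (_ : [set w | _] = [set w | Th j.+1 w <= theta]) // cdfTh //=.
  by rewrite /Theta_cdf (negbTE ne).
case: a => //; have := sum_lawT (measurable_le_level theta) j.+1.
rewrite big_bool lawt => /(canRL (addKr _)) ->.
by field; rewrite nat1r.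
Qed.

(** By [same_box_colouring] the word is forced except at position 0, whose two values have total
    probability 1. The other letters give the weight divided by their denominators, whose product is
    the rising factorial. *)
Lemma sum_law_arrangement (n : nat) (s : 'S_n.+1) (p : {set {set 'I_n.+1}}) :
  finset.partition p [set: 'I_n.+1]%SET ->
  \sum_(A : {ffun 'I_n.+1 -> bool})
     (partition_of_word A s == p)%:R * \prod_(j < n.+1) law level j (A j) =
  colour_weight theta (fun i => finset.pblock p (s i)) / rising (theta + 1) n.
Proof.
move=> pp; set f := fun i => finset.pblock p (s i).
pose Q (j : 'I_n.+1) : pred bool := fun a =>
  if unlift ord0 j is Some k then a == (f (lift ord_max k) != f (lift ord0 k)) else true.
have eqQ (A : {ffun 'I_n.+1 -> bool}) :
    (partition_of_word A s == p) = contiguous f && (A \in family Q).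
  apply/eqP/andP => [/(partition_of_word_eq _ _ pp)/same_box_colouring[cf h]|[cf /familyP h]].
    split=> //; apply/familyP => j; rewrite unfold_in /Q.
    by case: unliftP => // k ->; rewrite h.
  apply/(partition_of_word_eq _ _ pp)/same_box_colouring; split=> // k.
  by apply/eqP; have := h (lift ord0 k); rewrite unfold_in /Q liftK.
under eq_bigr => A _ do rewrite eqQ.
rewrite /colour_weight; case: (contiguous f); last by rewrite !mul0r big1 // => A _; rewrite mul0r.
transitivity (\sum_(A in family Q) \prod_(j < n.+1) law level j (A j)).
  rewrite [RHS]big_mkcond; apply: eq_bigr => A _ /=.
  by case: ifP; rewrite ?mul1r ?mul0r.
rewrite -(bigA_distr_big_dep _ (fun j => law level (nat_of_ord j))) big_ord_recl.
rewrite (eq_bigl xpredT) => [|a]; last by rewrite /Q unlift_none.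
rewrite /= (sum_lawT (measurable_le_level theta)) !mul1r /rising -prodf_div.
apply: eq_bigr => k _.
rewrite (big_pred1 (f (lift ord_max k) != f (lift ord0 k))) => [|a]; last by rewrite /Q liftK.
by rewrite (law_level k) -natr1 -addrA (addrC 1); case: eqP.
Qed.

Lemma probability_Pi_proc (n : nat) (p : {set {set 'I_n}}) :
  (0 < n)%N -> finset.partition p [set: 'I_n]%SET ->
  P [set w | Pi_proc Th sigma n theta w = p] = (ewens_prob theta p)%:E.
Proof.
case: n p => // n p _ pp; have /and3P[/eqP cov tI n0] := pp.
pose phi s (A : {ffun 'I_n.+1 -> bool}) := partition_of_word A s == p.
rewrite (_ : [set w | _] =
    [set w | phi (sigma n.+1 w) [ffun j : 'I_n.+1 => level (Th j w)]]); last first.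
  have e w : ([ffun j : 'I_n.+1 => level (Th j w)] : {ffun 'I_n.+1 -> bool}) =
      (fun i : 'I_n.+1 => Th i w <= theta) :> ('I_n.+1 -> bool).
    by apply: funext => i; rewrite ffunE.
  by apply/seteqP; split=> w /=; rewrite /phi e => /eqP.
rewrite (probability_process (measurable_le_level theta) phi) /phi; congr EFin.
under eq_bigr => s _.
  under eq_bigr => A _ do rewrite mulrCA.
  rewrite -mulr_sumr sum_law_arrangement //.
over.
rewrite -mulr_sumr -mulr_suml.
(* Each of the [n.+1] labels in last position gives the same sum, so n! becomes (n+1)! and cancels
   the normalisation of the uniform law. *)
rewrite (partition_big (fun s : 'S_n.+1 => s ord_max) xpredT) //=.
under eq_bigr => x _ do rewrite (sum_colour_weight _ (finset.pblock p)).
rewrite sumr_const card_ord /ewens_prob /=.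
have -> : [set finset.pblock p i | i : 'I_n.+1]%SET = p.
  apply/setP => A; apply/imsetP/idP => [[i _ ->]|Ap].
    by rewrite finset.pblock_mem // cov.
  have [A0|[x xA]] := set_0Vmem A; first by rewrite A0 (negbTE n0) in Ap.
  by exists x => //; apply/esym/finset.def_pblock.
(* A set that is not a block of [p] is the colour of no label and gives the factor 0! = 1. *)
have -> : \prod_(A : {set 'I_n.+1}) ((#|[set i | finset.pblock p i == A]%SET|.-1)`!)%:R =
    \prod_(A in p) ((#|A|.-1)`!)%:R :> R.
  rewrite [RHS]big_mkcond; apply: eq_bigr => A _; case: ifP => Ap.
    congr (((#|pred_of_set _|.-1)`!)%:R); apply/setP => i; rewrite inE.
    apply/eqP/idP => [<-|]; first by rewrite finset.mem_pblock cov.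
    exact: finset.def_pblock.
  rewrite (_ : [set i | _]%SET = finset.set0) ?finset.cards0 //; apply/setP => i.
  rewrite !inE; apply/eqP => e; case/negP: Ap; rewrite -e.
  by rewrite finset.pblock_mem // cov.
have nf : (n`!)%:R != 0 :> R by rewrite pnatr_eq0 -lt0n fact_gt0.
have n1 : n.+1%:R != 0 :> R by rewrite pnatr_eq0.
have rn : rising (theta + 1) n != 0.
  apply/prodf_neq0 => i _; rewrite -addrA nat1r gt_eqF // ltr_wpDl // ltr0Sn.
rewrite -[X in _ * (X / _)]mulr_natl factS natrM; move: nf n1 rn (theta ^+ _) (\prod_(_ in _) _).
move: (n`!)%:R n.+1%:R (rising _ _) => u v x u0 v0 x0 y z.
by field; rewrite u0 v0 x0.
Qed.

End EwensLaw.

(** * Finite-dimensional laws: exchangeability and consistency *)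

Section FiniteDimensionalLaws.
Variables (r : nat) (th : 'I_r -> R).
(** One letter records the cuts at all levels at once; the minimum of two reals corresponds to the
    union of their sets. *)
Let levels (x : R) : {set 'I_r} := [set q | x <= th q]%SET.

Lemma measurable_levels (A : {set 'I_r}) : measurable [set x | levels x = A].
Proof.
rewrite (_ : [set x | _] = \bigcap_(q in [set: 'I_r]) [set x | (x <= th q) = (q \in A)]).
  by apply: fin_bigcap_measurable => [|q _]; [exact: finite_finset | exact: measurable_le_level].
apply/seteqP; split=> [x /= <- q _ /= | x h]; first by rewrite inE.
by apply/setP => q; rewrite inE; apply: h.
Qed.

Lemma probability_Pi_procs (n : nat) (phi : pred {ffun 'I_r -> {set {set 'I_n}}}) :
  P [set w | phi [ffun q => Pi_proc Th sigma n (th q) w]] =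
  (\sum_s \sum_(A : {ffun 'I_n -> {set 'I_r}})
    (phi [ffun q => partition_of_word (fun i => q \in A i) s])%:R *
    ((n`!%:R)^-1 * \prod_(j < n) law levels j (A j)))%:E.
Proof.
rewrite -(probability_process measurable_levels (fun s (A : {ffun 'I_n -> {set 'I_r}}) =>
   phi [ffun q => partition_of_word (fun i => q \in A i) s])).
congr (P _); apply/funext => w /=; congr (is_true (phi _)).
apply/ffunP => q; rewrite !ffunE; congr (partition_of_word _ _).
by apply/funext => i; rewrite ffunE inE.
Qed.

Lemma probability_perm_Pi_procs (n : nat) (t : 'S_n)
    (phi : pred {ffun 'I_r -> {set {set 'I_n}}}) :
  P [set w | phi [ffun q => perm_partition t (Pi_proc Th sigma n (th q) w)]] =
  P [set w | phi [ffun q => Pi_proc Th sigma n (th q) w]].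
Proof.
pose phi' (f : {ffun 'I_r -> {set {set 'I_n}}}) := phi [ffun q => perm_partition t (f q)].
rewrite (_ : [set w | _] = [set w | phi' [ffun q => Pi_proc Th sigma n (th q) w]]); last first.
  apply/funext => w /=; congr (is_true (phi _)).
  by apply/ffunP => q; rewrite !ffunE.
rewrite !probability_Pi_procs; congr EFin; rewrite [RHS](reindex_inj (mulIg t)).
apply: eq_bigr => s _; apply: eq_bigr => A _; congr ((nat_of_bool (phi _))%:R * _).
by apply/ffunP => q; rewrite !ffunE perm_partition_of_word.
Qed.

Hypothesis th_ge0 : forall q, 0 <= th q.

(** [levels x] is contained in [B] iff [x] exceeds every level outside [B], that is, the largest of
    them; this level is the witness [theta]. If [B] is full there is no such level and the event is
    certain. *)
Lemma cumul_law_levels (B : {set 'I_r}) :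
  (forall j, \sum_(A : {set 'I_r} | A \subset B) law levels j A = 1) \/
  exists2 theta : R, 0 <= theta &
    forall j, \sum_(A : {set 'I_r} | A \subset B) law levels j A = 1 - Theta_cdf j theta.
Proof.
have [->|] := eqVneq B [set: 'I_r]%SET.
  left=> j; rewrite -(sum_lawT measurable_levels j).
  by apply: eq_bigl => A; rewrite finset.subsetT.
rewrite -finset.subTset => /fintype.subsetPn[q0 _ q0B]; right.
case: (@Order.TotalTheory.arg_maxP _ _ _ q0 (fun q => q \notin B) th q0B) => q qB qmax.
exists (th q) => // j; apply: EFin_inj; rewrite (sum_law measurable_levels).
have mq : measurable [set w | Th j w <= th q].
  have := mTh j measurableT (measurable_le_level (th q) true).
  by rewrite setTI.
rewrite EFinB -cdfTh // -(probability_setC P mq); congr (P _).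
apply/seteqP; split=> w /=.
  by move=> /fintype.subsetP/(_ q); rewrite inE => h /h; apply/negP.
move=> /negP; rewrite -ltNge => lt_q; apply/fintype.subsetP => q'; rewrite inE.
apply: contraLR => /qmax; rewrite -ltNge; move/le_lt_trans; apply.
exact: lt_q.
Qed.

Lemma cumul_law_mul (j : nat) (B : {set 'I_r}) :
  let S k := \sum_(A : {set 'I_r} | A \subset B) law levels k A in
  S j * S j.+1 = j.+1%:R * S j - j%:R * S j.+1.
Proof.
case: (cumul_law_levels B) => [h|[theta t0 h]] /=; rewrite !h.
  by rewrite !mulr1 -natr1 addrAC subrr add0r.
exact: Theta_survival_mul.
Qed.

Lemma probability_restr_Pi_procsS (n : nat) (phi : pred {ffun 'I_r -> {set {set 'I_n}}}) :
  P [set w | phi [ffun q => restr_partition n (Pi_proc Th sigma n.+1 (th q) w)]] =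
  P [set w | phi [ffun q => Pi_proc Th sigma n (th q) w]].
Proof.
pose phi' (f : {ffun 'I_r -> {set {set 'I_n.+1}}}) := phi [ffun q => restr_partition n (f q)].
rewrite (_ : [set w | _] = [set w | phi' [ffun q => Pi_proc Th sigma n.+1 (th q) w]]); last first.
  apply/funext => w /=; congr (is_true (phi _)).
  by apply/ffunP => q; rewrite !ffunE.
rewrite !probability_Pi_procs; congr EFin.
(* Split according to the position [i] of the largest label; the other labels are arranged by a
   permutation in ['S_n]. *)
rewrite (sum_lift_perm_preimage ord_max) exchange_big /=; apply: eq_bigr => s _.
pose G (A : {ffun 'I_n -> {set 'I_r}}) : R :=
  (phi [ffun q => partition_of_word (fun i => q \in A i) s])%:R.
transitivity (((n.+1)`!%:R)^-1 * \sum_(i < n.+1) \sum_(A : {ffun 'I_n.+1 -> {set 'I_r}})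
    G (merge_gaps i A) * \prod_(j < n.+1) law levels j (A j)).
  rewrite mulr_sumr; apply: eq_bigr => i _; rewrite mulr_sumr; apply: eq_bigr => A _.
  rewrite mulrCA; congr (_ * ((nat_of_bool (phi _))%:R * _)).
  apply/ffunP => q; rewrite !ffunE restr_partition_of_word; congr (partition_of_word _ _).
  apply/funext => k; rewrite ffunE /delete_letter finset.inE.
  by case: eqP => _ //=; rewrite finset.inE.
(* The factor [n.+1] produced here turns 1/(n+1)! into 1/n!. *)
rewrite (sum_merge_positions (sum_lawT measurable_levels) cumul_law_mul) factS natrM.
rewrite invfM mulrACA mulVf ?pnatr_eq0 // mul1r mulr_sumr.
by apply: eq_bigr => A _; rewrite mulrCA.
Qed.

(** Labels are removed one at a time, since restrictions compose. *)
Lemma probability_restr_Pi_procs (n m : nat) (phi : pred {ffun 'I_r -> {set {set 'I_n}}}) :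
  (n < m)%N ->
  P [set w | phi [ffun q => restr_partition n (Pi_proc Th sigma m (th q) w)]] =
  P [set w | phi [ffun q => Pi_proc Th sigma n (th q) w]].
Proof.
elim: m => // m IHm; rewrite ltnS leq_eqVlt => /predU1P[e|nm].
  by subst m; exact: probability_restr_Pi_procsS.
rewrite -(IHm nm).
pose phi' (f : {ffun 'I_r -> {set {set 'I_m}}}) := phi [ffun q => restr_partition n (f q)].
transitivity (P [set w | phi' [ffun q => restr_partition m (Pi_proc Th sigma m.+1 (th q) w)]]).
  congr (P _); apply/funext => w /=; congr (is_true (phi _)).
  by apply/ffunP => q; rewrite !ffunE restr_restr_partition // ltnW.
rewrite probability_restr_Pi_procsS; congr (P _); apply/funext => w /=.
by congr (is_true (phi _)); apply/ffunP => q; rewrite !ffunE.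
Qed.

End FiniteDimensionalLaws.
End Process.

(** Puts the list events of [EwensFragmentationFamily] in the form treated above: a predicate on a
    finite function indexed by the entries of [tp]. *)
Lemma all_fdd_event (T R : Type) (F : eqType) (X : R -> T -> F) (tp : seq (R * F)) :
  [set w | all (fun q => X q.1 w == q.2) tp] =
  [set w | [forall i, [ffun q => X (tnth (in_tuple tp) q).1 w] i ==
                      (tnth (in_tuple tp) i).2]].
Proof.
apply/seteqP; split=> w /=.
  by move=> /(@all_tnthP _ _ _ (in_tuple tp)) h; apply/forallP => i; rewrite ffunE.
move=> /forallP h; apply/(@all_tnthP _ _ _ (in_tuple tp)) => i.
by have := h i; rewrite ffunE.
Qed.

Theorem theorem1 (d : measure_display) (T : measurableType d) (R : realType)
  (P : probability T R) (Th : nat -> T -> R) (sigma : forall n : nat, T -> {perm 'I_n}) :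
  (* measurability *)
  (forall j, measurable_fun setT (Th j)) ->
  (forall (n : nat) (s : {perm 'I_n}), measurable [set w | sigma n w = s]) ->
  (* Th j = Theta_{j+1}, with P(Theta_{j+1} <= theta) = theta/(theta+j), 0/0 = 1 *)
  (forall (j : nat) (theta : R), 0 <= theta ->
      P [set w | Th j w <= theta] = (Theta_cdf j theta)%:E) ->
  (* the Theta's are mutually independent *)
  (forall (J : seq nat) (B : nat -> set R), uniq J -> (forall j, measurable (B j)) ->
      P [set w | forall j, j \in J -> B j (Th j w)]
      = (\prod_(j <- J) P [set w | B j (Th j w)])%E) ->
  (* sigma_n is a uniform permutation of [n], independent of (Theta_j)_j *)
  (forall (n : nat) (s : {perm 'I_n}) (J : seq nat) (B : nat -> set R),
      (forall j, measurable (B j)) ->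
      P [set w | sigma n w = s /\ forall j, j \in J -> B j (Th j w)]
      = (((n`!%:R)^-1)%:E * P [set w | forall j, j \in J -> B j (Th j w)])%E) ->
  EwensFragmentationFamily P (fun n theta w => Pi_proc Th sigma n theta w).
Proof.
move=> mTh msigma cdfTh indepTh indep_sigma; split; [|split; [|split]].
- by move=> n theta p n0 theta0 pp; apply: probability_Pi_proc.
- move=> n _; apply: aeW => w phi theta _ lt_phi_theta.
  by apply: refines_partition_of_word => k /le_trans; apply; apply: ltW.
- move=> n m tp _ nm /(@all_tnthP _ _ _ (in_tuple tp)) tp0.
  rewrite (all_fdd_event (fun t w => restr_partition n (Pi_proc Th sigma m t w))).
  rewrite (all_fdd_event (fun t w => Pi_proc Th sigma n t w)).
  exact: (probability_restr_Pi_procs mTh msigma cdfTh indepTh indep_sigma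
    (th := fun q => (tnth (in_tuple tp) q).1) tp0
    (fun f => [forall i, f i == (tnth (in_tuple tp) i).2]) nm).
- move=> n s tp _ _.
  rewrite (all_fdd_event (fun t w => perm_partition s (Pi_proc Th sigma n t w))).
  rewrite (all_fdd_event (fun t w => Pi_proc Th sigma n t w)).
  exact: (probability_perm_Pi_procs mTh msigma indepTh indep_sigma
    (fun q => (tnth (in_tuple tp) q).1) s
    (fun f => [forall i, f i == (tnth (in_tuple tp) i).2])).
Qed.
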